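(* Let $m_0$ and $m$ be natural numbers with $m\ge m_0$, and let $f\in C^{2m-}$. Suppose that $f^{(2j-1)}(x)\to0$ as $x\to\infty$ for $j=m_0,\dots,m-1$ and that $\int_0^\infty|f^{(2m-1)}(x)|\,dx<\infty$. Let $F$ be any antiderivative of $f$. Then for any natural $c$ $$\sum_{k\ge0}^{\mathrm{EM}}f(k)=\sum_{k=0}^{c}f(k)-G^{\mathrm{EM}}_{m,F}(c+1)+R^{\mathrm{EM}}_{m,f_c}(\infty).$$
   Context: For a natural number $\alpha$, $C^{\alpha-}$ denotes the set of all functions $f:\mathbb R\to\mathbb R$ having continuous derivatives $f^{(i)}$ of all orders $i=0,\dots,\alpha-1$ and such that $f^{(\alpha-1)}$ is absolutely continuous, with a Radon–Nikodym derivative denoted by $f^{(\alpha)}$. For a function $h:\mathbb R\to\mathbb R$ and real $c$, $h_c(x):=h(x+c)$ for all real $x$. Bernoulli polynomials: $B_0(x)=1$, $B_j'(x)=jB_{j-1}(x)$, $\int_0^1B_j(x)\,dx=0$ for $j\ge1$; Bernoulli numbers $B_j=B_j(0)$ for $j\ge2$. For natural $m$, $$G^{\mathrm{EM}}_{m,F}(n):=F(n-1)+\frac{F'(n-1)}2+\sum_{j=1}^{m-1}\frac{B_{2j}}{(2j)!}F^{(2j)}(n-1),$$ $$R^{\mathrm{EM}}_{m,f}(\infty):=\frac1{(2m-1)!}\int_0^\infty f^{(2m-1)}(x)\,B_{2m-1}(x-\lfloor x\rfloor)\,dx,$$ and $$\sum_{k\ge0}^{\mathrm{EM}}f(k):=\lim_{n\to\infty}\Big(\sum_{k=0}^{n-1}f(k)-G^{\mathrm{EM}}_{m_0,F}(n)\Big).$$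 The sum of an empty family is $0$. *)

(* Defs.v *)
From mathcomp Require Import all_boot all_order all_algebra.
From mathcomp Require Import all_classical all_reals all_analysis.

Set Implicit Arguments.
Unset Strict Implicit.
Unset Printing Implicit Defensive.

Import Order.TTheory GRing.Theory Num.Theory.
Import numFieldNormedType.Exports.

Local Open Scope classical_set_scope.
Local Open Scope ring_scope.

Definition abs_continuous_on (R : realType) (a b : R) (g : R -> R) : Prop :=
  forall eps : R, 0 < eps -> exists2 delta : R, 0 < delta &
    forall (n : nat) (l r : 'I_n -> R),
      (forall i, [/\ a <= l i, l i <= r i & r i <= b]) ->
      trivIset setT (fun i => [set` `]l i, r i[ ]) ->
      \sum_(i < n) (r i - l i) < delta ->
      \sum_(i < n) `|g (r i) - g (l i)| < eps.

(* On the whole line absolute continuity is meant on every compact interval: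
   this is equivalent to having a locally integrable Radon-Nikodym derivative,
   and does not exclude, e.g., polynomials. *)
Definition abs_continuous (R : realType) (g : R -> R) : Prop :=
  forall a b : R, a <= b -> abs_continuous_on a b g.

(* The class C^{alpha-}.  Since [f^`(i)] is a total operator, the existence of
   the derivatives of orders 1, ..., alpha - 1 is required separately. *)
Definition Cminus (R : realType) (alpha : nat) (f : R -> R) : Prop :=
  [/\ (0 < alpha)%N,
      forall i : nat, (i.+1 < alpha)%N ->
        forall x : R, derivable (f^`(i)%classic) x 1,
      forall i : nat, (i < alpha)%N -> continuous (f^`(i)%classic) &
      abs_continuous (f^`(alpha.-1)%classic)].

Definition antiderivative (R : realType) (F f : R -> R) : Prop :=
  forall x : R, is_derive x 1 F (f x).

(* The primitive of p vanishing at 0; the coefficient of index 0 is p`_0 / 0,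
   which is 0 in a MathComp field. *)
Definition poly_primitive (R : realType) (p : {poly R}) : {poly R} :=
  \poly_(i < (size p).+1) (p`_i.-1 / i%:R).

(* B_j is the primitive of j * B_(j-1) whose integral over [0, 1] vanishes;
   see [deriv_bernoulli] and [Rintegral_bernoulli]. *)
Fixpoint bernoulli_poly (R : realType) (j : nat) : {poly R} :=
  if j is i.+1 then
    let P := poly_primitive (j%:R *: bernoulli_poly R i) in
    P - (\int[@lebesgue_measure R]_(x in `[0, 1]) P.[x])%:P
  else 1.

Definition bernoulli_number (R : realType) (j : nat) : R :=
  (bernoulli_poly R j).[0].

Lemma deriv_poly_primitive (R : realType) (p : {poly R}) :
  (poly_primitive p)^`() = p.
Proof.
apply/polyP => i; rewrite coef_deriv coef_poly ltnS /=.
case: ltnP => [_|/(nth_default 0) ->]; last by rewrite mul0rn.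
by rewrite -[LHS]mulr_natr divfK// pnatr_eq0.
Qed.

Lemma deriv_bernoulli (R : realType) (j : nat) :
  (bernoulli_poly R j.+1)^`() = j.+1%:R *: bernoulli_poly R j.
Proof. by rewrite /= derivB derivC subr0 deriv_poly_primitive. Qed.

Lemma integrable_poly01 (R : realType) (p : {poly R}) :
  (@lebesgue_measure R).-integrable `[0, 1] (EFin \o horner p).
Proof.
apply: continuous_compact_integrable; first exact: segment_compact.
by apply: continuous_subspaceT => x; exact: continuous_horner.
Qed.

Lemma Rintegral_bernoulli (R : realType) (j : nat) :
  \int[@lebesgue_measure R]_(x in `[0, 1]) (bernoulli_poly R j.+1).[x] = 0.
Proof.
rewrite /=; set P := poly_primitive _; set c := (X in X%:P).
under eq_Rintegral do rewrite hornerD hornerN hornerC.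
rewrite RintegralB//; last 2 first.
- exact: integrable_poly01.
- have := integrable_poly01 c%:P; congr (integrable _ _ _).
  by apply/funext => x /=; rewrite hornerC.
rewrite Rintegral_cst// /= lebesgue_measure_itv/= lte_fin ltr01 sube0/= mulr1.
by rewrite subrr.
Qed.

Definition G_EM (R : realType) (m : nat) (F : R -> R) (n : nat) : R :=
  F (n%:R - 1) + F^`()%classic (n%:R - 1) / 2
  + \sum_(1 <= j < m) bernoulli_number R (2 * j) / (2 * j)`!%:R
                      * F^`(2 * j)%classic (n%:R - 1).

Definition R_EM (R : realType) (m : nat) (f : R -> R) : R :=
  (2 * m - 1)`!%:R^-1 *
  \int[@lebesgue_measure R]_(x in `[0, +oo[)
    (f^`(2 * m - 1)%classic x
     * (bernoulli_poly R (2 * m - 1)).[x - (Num.floor x)%:~R]).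

Definition EM_partial (R : realType) (m0 : nat) (f F : R -> R) : R^nat :=
  fun n => \sum_(0 <= k < n) f k%:R - G_EM m0 F n.

(* [lim] is a total operator: statements about [EM_sum] should also assert
   that [EM_partial m0 f F] converges. *)
Definition EM_sum (R : realType) (m0 : nat) (f F : R -> R) : R :=
  lim (EM_partial m0 f F @ \oo).

(* Main.v *)
Require Import Defs.
From mathcomp Require Import all_boot all_order all_algebra.
From mathcomp Require Import all_classical all_reals all_analysis.
From mathcomp Require Import measurable_realfun ring lra.
Import Order.TTheory GRing.Theory Num.Theory.
Import numFieldNormedType.Exports.

Local Open Scope classical_set_scope.
Local Open Scope ring_scope.

(* With [p = 2m - 1] and [b_i = B_i / i!], so that [b_i' = b_(i-1)], the
   function [H x = \sum_(i <= p) (-1)^i F^(i) x * b_i (x - k)] has the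
   telescoping derivative [(-1)^p F^(p+1) x * b_p (x - k)]. Integrating it over
   [[k, k+1]] gives the Euler-Maclaurin formula on one period, since [B_i 1 =
   B_i 0] for [i >= 2] and [B_i 0 = 0] for odd [i >= 3]. Summing over the
   periods and letting their number grow gives the remainder integral, because
   [B_p] is bounded on [[0, 1]] and [F^(p+1)] is integrable. Passing from [m]
   to [m0] only discards terms tending to 0. *)

(** * Bernoulli polynomials: reflection and boundary values *)

Lemma continuous_Rintegral_FTC2 {R : realType} (f F : R -> R) (a b : R) :
  a < b -> continuous f -> (forall x : R, is_derive x 1 F (f x)) ->
  \int[@lebesgue_measure R]_(x in `[a, b]) f x = F b - F a.
Proof.
move=> ab cf dF.
have cF : continuous F.
  by move=> x; apply/differentiable_continuous/derivable1_diffP; case: (dF x).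
rewrite /Rintegral (@continuous_FTC2 _ f F)//.
- exact: continuous_subspaceT.
- split => [x _||]; first by case: (dF x).
  + exact/cvg_at_right_filter/cF.
  + exact/cvg_at_left_filter/cF.
- by move=> x _; rewrite derive1E; case: (dF x).
Qed.

Lemma Rintegral01_deriv {R : realType} (p : {poly R}) :
  \int[@lebesgue_measure R]_(x in `[0, 1]) (p^`()%R).[x] = p.[1] - p.[0].
Proof.
apply: continuous_Rintegral_FTC2 => //; exact: continuous_horner.
Qed.

(** With [q] a primitive of [p], [- (q \Po (1 - 'X))] is a primitive of the reflected polynomial,
    and reflection swaps the endpoints. *)
Lemma Rintegral01_onem {R : realType} (p : {poly R}) :
  \int[@lebesgue_measure R]_(x in `[0, 1]) (p \Po (1 - 'X)).[x] =
  \int[@lebesgue_measure R]_(x in `[0, 1]) p.[x].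
Proof.
set q := poly_primitive p.
have -> : p \Po (1 - 'X) = (- (q \Po (1 - 'X)))^`()%R.
  rewrite derivN deriv_comp deriv_poly_primitive derivB derivX -polyC1 derivC.
  by rewrite sub0r mulrN1 opprK.
rewrite Rintegral01_deriv -[in RHS](deriv_poly_primitive p) Rintegral01_deriv.
by rewrite !hornerE !horner_comp !hornerE subrr subr0 -/q opprK addrC.
Qed.

Lemma deriv_eq0 {R : numDomainType} (p : {poly R}) :
  p^`()%R = 0 -> p = (p`_0)%:P.
Proof.
move=> p'0; apply/polyP => -[|i]; rewrite coefC//=.
have /eqP := congr1 (fun q : {poly R} => q`_i) p'0.
by rewrite coef_deriv coef0 mulrn_eq0 /= => /eqP.
Qed.

(** By induction both sides have the same derivative, so their difference [d] is constant; both have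
    mean 0 on [[0, 1]], so the constant is 0. *)
Lemma bernoulli_onem {R : realType} (j : nat) :
  bernoulli_poly R j \Po (1 - 'X) = (-1) ^+ j *: bernoulli_poly R j.
Proof.
elim: j => [|j IH]; first by rewrite expr0 scale1r /= -polyC1 comp_polyC.
apply/eqP; rewrite -subr_eq0; apply/eqP.
set d := _ - _.
have d'0 : d^`()%R = 0.
  rewrite derivB deriv_comp derivZ deriv_bernoulli derivB derivX -polyC1 derivC.
  rewrite sub0r mulrN1 polyC1 linearZ /= IH !scalerA exprS mulN1r.
  by rewrite mulNr scaleNr opprK [in X in _ + X]mulrC addNr.
have int_cst r : \int[@lebesgue_measure R]_(x in `[0, 1]) (r%:P).[x] = r.
  have -> : r%:P = (r *: 'X)^`()%R by rewrite derivZ derivX alg_polyC.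
  by rewrite Rintegral01_deriv !hornerE subr0.
rewrite (deriv_eq0 _ d'0) -(int_cst d`_0) -(deriv_eq0 _ d'0).
under eq_Rintegral do rewrite hornerD hornerN hornerZ.
rewrite RintegralB//; last 2 first.
- exact: integrable_poly01.
- have := integrable_poly01 ((-1) ^+ j.+1 *: bernoulli_poly R j.+1).
  by congr (integrable _ _ _); apply/funext => x /=; rewrite hornerZ.
rewrite Rintegral01_onem RintegralZl//; last exact: integrable_poly01.
by rewrite Rintegral_bernoulli mulr0 subr0.
Qed.

Lemma bernoulli_at1 {R : realType} (j : nat) :
  (bernoulli_poly R j).[1] = (-1) ^+ j * (bernoulli_poly R j).[0].
Proof.
have := congr1 (horner^~ 0) (bernoulli_onem (R := R) j).
by rewrite horner_comp !hornerE subr0.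
Qed.

(** The difference of the end values is the integral of a multiple of [B_(j+1)], whose mean is 0.
    This fails for [B_1], whose derivative [B_0] has mean 1. *)
Lemma bernoulli_periodic {R : realType} (j : nat) :
  (bernoulli_poly R j.+2).[1] = (bernoulli_poly R j.+2).[0].
Proof.
apply/eqP; rewrite -subr_eq0 -Rintegral01_deriv deriv_bernoulli.
under eq_Rintegral do rewrite hornerZ.
rewrite RintegralZl//; last exact: integrable_poly01.
by rewrite Rintegral_bernoulli mulr0.
Qed.

Lemma bernoulli1_at1 {R : realType} : (bernoulli_poly R 1).[1] = 2^-1.
Proof.
have := bernoulli_at1 (R := R) 1.
have := Rintegral01_deriv (bernoulli_poly R 1).
rewrite deriv_bernoulli scale1r.
have -> : bernoulli_poly R 0 = ('X)^`()%R by rewrite derivX.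
rewrite Rintegral01_deriv !hornerX subr0.
lra.
Qed.

(** Reflection equates the value at 1 with the opposite of the value at 0, while periodicity makes
    the two values equal. *)
Lemma bernoulli_odd_at0 {R : realType} (j : nat) :
  (bernoulli_poly R (2 * j).+3).[0] = 0.
Proof.
have := bernoulli_at1 (R := R) (2 * j).+3.
rewrite bernoulli_periodic -signr_odd /= mul2n odd_double /= expr1; lra.
Qed.

(** * Alternating sums at the ends of a period *)

Lemma alternating_sum_even {R : comNzRingType} (u b : nat -> R) (m : nat) :
  (forall j, b (2 * j).+3 = 0) ->
  \sum_(0 <= i < 2 * m.+1) (-1) ^+ i * (u i * b i)
  = u 0%N * b 0%N - u 1%N * b 1%N
    + \sum_(1 <= j < m.+1) b (2 * j)%N * u (2 * j)%N.
Proof.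
move=> b0; elim: m => [|m IH].
  rewrite muln1 big_nat_recr// big_nat1 big_geq// expr0 expr1.
  by rewrite mul1r mulN1r addr0.
have -> : (2 * m.+2 = (2 * m.+1).+2)%N by rewrite mulnS.
rewrite [LHS]big_nat_recr// [X in X + _ = _]big_nat_recr// IH.
rewrite [in RHS]big_nat_recr// -!addrA; do 3!congr (_ + _).
rewrite -signr_odd mul2n odd_double expr0 mul1r -mul2n [(2 * m.+1)%N]mulnS b0.
by rewrite !mulr0 addr0 mulrC.
Qed.

(** Serves for [t = 0] and [t = 1], between which only the [B_1] term differs. Odd indices from 3 on
    vanish, and even ones carry the sign 1. *)
Lemma alternating_bernoulli_sum {R : realType} (u : nat -> R) (t : R) (m : nat) :
  (forall j, (bernoulli_poly R j.+2).[t] = (bernoulli_poly R j.+2).[0]) ->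
  \sum_(0 <= i < 2 * m.+1)
    (-1) ^+ i * (u i * ((bernoulli_poly R i).[t] / i`!%:R))
  = u 0%N - u 1%N * (bernoulli_poly R 1).[t]
    + \sum_(1 <= j < m.+1) bernoulli_number R (2 * j) / (2 * j)`!%:R
                           * u (2 * j)%N.
Proof.
move=> Bt.
rewrite (alternating_sum_even u (fun i => (bernoulli_poly R i).[t] / i`!%:R));
  last first.
  by move=> j; rewrite Bt bernoulli_odd_at0 mul0r.
congr (_ - _ + _).
- by rewrite hornerC fact0 divr1 mulr1.
- by rewrite (_ : 1`! = 1)%N// divr1.
- apply: eq_big_nat => j /andP[j0 _].
  rewrite /bernoulli_number.
  have -> : (2 * j = (2 * j.-1).+2)%N by rewrite -[in LHS](prednK j0) mulnS.
  by rewrite Bt.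
Qed.

(* [G_EM m F n] for [u i] the value at [n - 1] of the [i]-th derivative of [F]. *)
Definition EM_correction {R : realType} (m : nat) (u : nat -> R) : R :=
  u 0%N + u 1%N / 2
  + \sum_(1 <= j < m) bernoulli_number R (2 * j) / (2 * j)`!%:R * u (2 * j)%N.

(** * The Euler-Maclaurin formula on one period *)

Lemma is_derive_alternating_sum {R : realType} (phi : nat -> R -> R) (a : R)
    (p : nat) (x : R) :
  (forall i, (i <= p)%N -> is_derive x (1 : R) (phi i) (phi i.+1 x)) ->
  is_derive x (1 : R)
    (fun y : R => \sum_(0 <= i < p.+1)
       (-1) ^+ i * (phi i y * ((bernoulli_poly R i).[y - a] / i`!%:R)))
    ((-1) ^+ p * (phi p.+1 x * ((bernoulli_poly R p).[x - a] / p`!%:R))).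
Proof.
have dB i : is_derive x (1 : R) (fun y : R => (bernoulli_poly R i).[y - a])
    ((bernoulli_poly R i)^`()%R).[x - a].
  rewrite -[X in is_derive _ _ _ X]mulr1.
  apply: (@is_derive1_comp _ (horner (bernoulli_poly R i)) (shift (- a))).
  exact: is_derive_shift.
have dterm i : is_derive x (1 : R) (phi i) (phi i.+1 x) ->
    is_derive x (1 : R)
      (fun y : R =>
        (-1) ^+ i * (phi i y * ((bernoulli_poly R i).[y - a] / i`!%:R)))
      ((-1) ^+ i * (phi i.+1 x * ((bernoulli_poly R i).[x - a] / i`!%:R)
         + phi i x * (((bernoulli_poly R i)^`()%R).[x - a] / i`!%:R))).
  move=> dphi; have dBi := dB i.
  have := is_deriveZ ((-1) ^+ i / i`!%:R) (is_deriveM dphi dBi).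
  have -> : (((-1) ^+ i / i`!%:R) \*:
        (phi i * (fun y : R => (bernoulli_poly R i).[y - a])))
      = (fun y : R =>
          (-1) ^+ i * (phi i y * ((bernoulli_poly R i).[y - a] / i`!%:R))).
    apply/funext => y.
    rewrite -[LHS]/((-1) ^+ i / i`!%:R *
      (phi i y * (bernoulli_poly R i).[y - a])).
    by ring.
  move/is_derive_eq; apply; rewrite /GRing.scale /=; ring.
elim: p => [|p IH] dphi.
  under eq_fun do rewrite big_nat1.
  have := dterm 0%N (dphi 0%N (leqnn 0)).
  move/is_derive_eq; apply.
  by rewrite -[bernoulli_poly R 0]/(1%:P) derivC horner0 mul0r mulr0 addr0.
under eq_fun do rewrite big_nat_recr//.
have := is_deriveD (IH (fun i ip => dphi i (leqW ip)))
  (dterm p.+1 (dphi p.+1 (leqnn _))).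
move/is_derive_eq; apply.
(* The factor [p.+1] from the derivative of [B_(p+1)] reduces [p.+1]![to]p[!], so this half of the
   new term cancels the derivative given by [IH]. *)
rewrite deriv_bernoulli hornerZ factS natrM.
set B0 := (bernoulli_poly R p).[x - a].
set B1 := (bernoulli_poly R p.+1).[x - a].
have f0 : p`!%:R != 0 :> R by rewrite pnatr_eq0 -lt0n fact_gt0.
have p0 : p.+1%:R != 0 :> R by rewrite pnatr_eq0.
rewrite exprS; field.
by rewrite f0 addrC natr1.
Qed.

Lemma continuous_horner_center {R : realType} (p : {poly R}) (a : R) :
  continuous (fun x : R => p.[x - a]).
Proof.
move=> x; apply: (@continuous_comp _ _ _ (shift (- a)) (horner p)).
  by apply: continuousD; [exact: cvg_id | exact: cvg_cst].
exact: continuous_horner.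
Qed.

(** At [a], where [B_1] takes the value [-1/2], [H] equals the correction. At [a + 1] the value is
    [1/2], so [H] falls short of it by [phi 1 (a + 1)]. *)
Lemma euler_maclaurin_unit {R : realType} (m : nat) (phi : nat -> R -> R)
    (a : R) :
  (forall i, (i <= (2 * m).+1)%N ->
     forall x : R, is_derive x 1 (phi i) (phi i.+1 x)) ->
  continuous (phi (2 * m).+2) ->
  ((2 * m).+1)`!%:R^-1 *
   \int[@lebesgue_measure R]_(x in `[a, a + 1])
     (phi (2 * m).+2 x * (bernoulli_poly R (2 * m).+1).[x - a]) =
  phi 1%N (a + 1)
  - (EM_correction m.+1 (phi ^~ (a + 1)) - EM_correction m.+1 (phi ^~ a)).
Proof.
move=> dphi cphi.
pose p := (2 * m).+1; pose B := bernoulli_poly R p.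
pose H y := \sum_(0 <= i < p.+1)
  (-1) ^+ i * (phi i y * ((bernoulli_poly R i).[y - a] / i`!%:R)).
have f0 : p`!%:R != 0 :> R by rewrite pnatr_eq0 -lt0n fact_gt0.
have sgn : (-1) ^+ p = -1 :> R.
  by rewrite -signr_odd /p oddS mul2n odd_double expr1.
have dH (x : R) : is_derive x (1 : R) (- p`!%:R \*: H)
    (phi (2 * m).+2 x * B.[x - a]).
  have := is_deriveZ (- p`!%:R)
    (is_derive_alternating_sum phi a p x (fun i ip => dphi i ip x)).
  move/is_derive_eq; apply; rewrite sgn /GRing.scale /=.
  by rewrite -/p -/B; field.
have ch : continuous (fun x => phi (2 * m).+2 x * B.[x - a]).
  move=> x; apply: cvgM; first exact: cphi.
  exact: continuous_horner_center.
have aa1 : a < a + 1 by rewrite ltrDl.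
rewrite (continuous_Rintegral_FTC2 _ _ _ _ aa1 ch dH).
rewrite -/p /GRing.scale /= -mulrBr mulrA mulrN mulVf// mulN1r opprB.
rewrite /H /p (_ : (2 * m).+2 = 2 * m.+1)%N; last by rewrite mulnS.
rewrite (@alternating_bernoulli_sum _ (phi ^~ (a + 1))); last first.
  by move=> j; rewrite addrAC subrr add0r bernoulli_periodic.
rewrite (@alternating_bernoulli_sum _ (phi ^~ a)); last first.
  by move=> j; rewrite subrr.
have b1 := bernoulli_at1 (R := R) 1.
rewrite bernoulli1_at1 in b1.
have -> : a + 1 - a = 1 by ring.
rewrite subrr bernoulli1_at1.
have -> : (bernoulli_poly R 1).[0] = - 2^-1 by rewrite b1 expr1 mulN1r opprK.
by rewrite /EM_correction; field.
Qed.

(** * The periodic kernel and the remainder integral *)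

(** The floor is constant on the half-open interval. Adding the right endpoint, a null set, gives a
    continuous integrand on a compact interval. *)
Lemma Rintegral_frac {R : realType} (f : R -> R) (p : {poly R}) (k : nat) :
  continuous f ->
  \int[@lebesgue_measure R]_(x in `[k%:R, k%:R + 1[)
    (f x * p.[x - (Num.floor x)%:~R]) =
  \int[@lebesgue_measure R]_(x in `[k%:R, k%:R + 1]) (f x * p.[x - k%:R]).
Proof.
move=> cf; rewrite -Rintegral_itv_bndo_bndc.
  apply: eq_Rintegral => x; rewrite inE/= in_itv/= => kx.
  have -> // : Num.floor x = k%:Z.
  by apply: floor_def; rewrite intrD.
have ck : continuous (fun x : R => f x * p.[x - k%:R]).
  move=> x; apply: cvgM; first exact: cf.
  exact: continuous_horner_center.
have intk : (@lebesgue_measure R).-integrable `[k%:R, k%:R + 1]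
    (EFin \o (fun x : R => f x * p.[x - k%:R])).
  apply: continuous_compact_integrable; first exact: segment_compact.
  exact: continuous_subspaceT.
apply: integrableS intk => //.
by move=> x /=; rewrite !in_itv/= => /andP[-> /ltW].
Qed.

(** Fractional parts stay in [[0, 1]], where [p] is bounded by some [M]; hence [M * f] dominates. *)
Lemma integrable_mul_frac {R : realType} (i : interval R) (f : R -> R)
    (p : {poly R}) :
  (@lebesgue_measure R).-integrable [set` i] (EFin \o f) ->
  (@lebesgue_measure R).-integrable [set` i]
    (EFin \o (fun x => f x * p.[x - (Num.floor x)%:~R])).
Proof.
move=> intf.
have mf : measurable_fun [set` i] f.
  by apply/measurable_EFinP; exact: measurable_int intf.
have mfrac : measurable_fun setT (fun x : R => x - (Num.floor x)%:~R).
  apply: measurable_funB; first exact: measurable_id.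
  (* The floor is measurable because it is monotone. *)
  apply: nondecreasing_measurable => // x y xy.
  by rewrite ler_int le_floor.
have mpfrac : measurable_fun setT (fun x : R => p.[x - (Num.floor x)%:~R]).
  apply: (measurableT_comp _ mfrac).
  by apply: continuous_measurable_fun; exact: continuous_horner.
have [M pM] := poly_itv_bound p 0 1.
apply: le_integrable (integrableZl _ M intf) => //.
- apply/measurable_EFinP; apply: measurable_funM => //.
  exact: measurable_funTS mpfrac.
- move=> x _ /=; rewrite lee_fin !normrM mulrC ler_wpM2r//.
  apply: le_trans (ler_norm M); apply: pM.
  by rewrite subr_ge0 floor_le/= lerBlDl ltW// -[1]/(1%:~R) -intrD floorD1_gt.
Qed.

(** Dominated convergence for the truncations of [h] to [[0, n[], with dominating function [|h|]. *)
Lemma cvg_Rintegral_nat {R : realType} (h : R -> R) :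
  (@lebesgue_measure R).-integrable `[0, +oo[ (EFin \o h) ->
  \int[@lebesgue_measure R]_(x in `[0, n%:R[) h x @[n --> \oo] -->
  \int[@lebesgue_measure R]_(x in `[0, +oo[) h x.
Proof.
move=> inth.
have mh := measurable_int _ inth.
pose h_ (n : nat) := (EFin \o h) \_ `[0%R, n%:R[.
have [|||||_ _] := @dominated_convergence _ _ R (@lebesgue_measure R)
  `[0%R, +oo[ (measurable_itv _) h_ (EFin \o h) (abse \o (EFin \o h)).
- move=> n; apply/measurable_restrict => //.
  by apply: measurable_funS mh => //; exact: subIsetr.
- exact: mh.
(* At a fixed [x] the truncations equal [h x] as soon as [n > x]. *)
- apply: aeW => x /= x0; apply: cvg_near_cst.
  near=> n; rewrite /h_ patchE ifT// inE/= in_itv/=.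
  rewrite in_itv/= andbT in x0; rewrite x0/=.
  by near: n; exact: nbhs_infty_gtr.
- exact: integrable_abse.
- apply: aeW => x /= n _; rewrite /h_ patchE; case: ifP => // _.
  (* Outside [[0, n[] the restriction takes the default value [point], which is 0. *)
  by rewrite -[point]/(0%:E) abse0 lee_fin.
have -> : (fun n => \int[@lebesgue_measure R]_(x in `[0%R, +oo[) h_ n x)%E =
    (fun n => \int[@lebesgue_measure R]_(x in `[0%R, n%:R[) (h x)%:E)%E.
  apply/funext => n; rewrite -integral_mkcondr setIidr// => x /=.
  by rewrite !in_itv/= => /andP[-> _].
move=> cv; apply: fine_cvg.
rewrite /Rintegral fineK//.
exact: integrable_fin_num.
Unshelve. all: by end_near.
Qed.

(** Adding the one-period formulas telescopes the corrections. Half-open intervals let [[0, n+1[]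
    split into disjoint pieces. *)
Lemma euler_maclaurin_sum {R : realType} (m : nat) (phi : nat -> R -> R)
    (n : nat) :
  (forall i, (i <= (2 * m).+1)%N ->
     forall x : R, is_derive x 1 (phi i) (phi i.+1 x)) ->
  continuous (phi (2 * m).+2) ->
  (@lebesgue_measure R).-integrable `[0, +oo[ (EFin \o phi (2 * m).+2) ->
  ((2 * m).+1)`!%:R^-1 *
   \int[@lebesgue_measure R]_(x in `[0, n%:R[)
     (phi (2 * m).+2 x *
      (bernoulli_poly R (2 * m).+1).[x - (Num.floor x)%:~R]) =
  \sum_(0 <= k < n) phi 1%N (k%:R + 1)
  - (EM_correction m.+1 (phi ^~ n%:R) - EM_correction m.+1 (phi ^~ 0)).
Proof.
move=> dphi cphi iphi; elim: n => [|n IH].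
  by rewrite set_itv_ge ?bnd_simp// Rintegral_set0 mulr0 big_geq// subrr subr0.
have n1 : n.+1%:R = n%:R + 1 :> R by rewrite natr1.
rewrite (@itv_bndbnd_setU _ _ _ (BLeft (n%:R : R))); last 2 first.
- by rewrite bnd_simp.
- by rewrite bnd_simp ler_nat.
rewrite Rintegral_setU//; last 2 first.
- rewrite -itv_bndbnd_setU ?bnd_simp ?ler_nat//.
  apply: integrableS (integrable_mul_frac _ _ _ iphi) => //.
  by move=> x /=; rewrite !in_itv/= => /andP[->].
- apply/disj_setPS => x [/=]; rewrite !in_itv/= => /andP[_ xn] /andP[nx _].
  by have := lt_le_trans xn nx; rewrite ltxx.
rewrite mulrDr IH [in X in _ + X]n1 Rintegral_frac// euler_maclaurin_unit//.
rewrite big_nat_recr//= n1; ring.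
Qed.

(** * Translation of the function *)

Lemma derive1n_shift {R : realType} (g : R -> R) (a : R) (n : nat) :
  (g \o shift a)^`(n)%classic = g^`(n)%classic \o shift a.
Proof.
elim: n => // n IH; rewrite !derive1nS IH.
apply/funext => x; rewrite /derive1 /=.
by under eq_fun do rewrite -addrA.
Qed.

(** Substituting [x + a] moves the integral of the norm to [[a, +oo[], which lies inside [[0, +oo[]
    because [a >= 0]. *)
Lemma integrable_shift {R : realType} (g : R -> R) (a : R) : 0 <= a ->
  continuous g ->
  (\int[@lebesgue_measure R]_(x in `[0%R, +oo[) (`|g x|%R)%:E < +oo)%E ->
  (@lebesgue_measure R).-integrable `[0, +oo[ (EFin \o (g \o shift a)).
Proof.
move=> a0 cg ig.
have cga : continuous (g \o shift a).
  move=> x; apply: continuous_comp; last exact: cg.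
  by apply: continuousD; [exact: cvg_id | exact: cvg_cst].
apply/integrableP; split.
  apply/measurable_EFinP; apply: measurable_funTS.
  exact: continuous_measurable_fun.
apply: le_lt_trans ig.
have d1 : (shift a)^`()%classic = cst (1 : R).
  by apply/funext => x; rewrite derive1E; case: (is_derive_shift x 1 a).
have -> : (\int[@lebesgue_measure R]_(x in `[0%R, +oo[)
    `|(EFin \o (g \o shift a)) x|
  = \int[@lebesgue_measure R]_(x in `[shift a 0, +oo[) (`|g x|%R)%:E)%E.
  rewrite (@increasing_ge0_integration_by_substitutiony _ (shift a)
    (fun x => `|g x|)).
  - by apply: eq_integral => x _; rewrite d1 /= fctE mulr1.
  - by move=> x y _ _ xy; rewrite ltrD2r.
  - by rewrite d1 => x _; exact: cvg_cst.
  - by rewrite d1; exact: is_cvg_cst.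
  - by rewrite d1; exact: is_cvg_cst.
  - split; first by move=> x _; case: (is_derive_shift x 1 a).
    apply: cvg_at_right_filter.
    by apply: cvgD; [exact: cvg_id | exact: cvg_cst].
  - apply/cvgryPge => A; near=> x; rewrite /= -lerBlDr.
    by near: x; apply: nbhs_pinfty_ge; rewrite num_real.
  - by apply: continuous_subspaceT => x; apply: cvg_norm; exact: cg.
  - by move=> x _.
apply: ge0_subset_integral => //.
- apply/measurable_EFinP; apply: measurable_funTS.
  by apply: measurableT_comp => //; exact: continuous_measurable_fun.
- by move=> x /=; rewrite !in_itv/= !andbT add0r; exact: le_trans.
Unshelve. all: by end_near.
Qed.

(** * Limit of the partial sums *)

Lemma cvg_sum0 {R : realType} (I : eqType) (r : seq I) (u : I -> nat -> R) :
  (forall i, i \in r -> u i n @[n --> \oo] --> 0) ->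
  (fun n => \sum_(i <- r) u i n) @ \oo --> 0.
Proof.
elim: r => [|i r IH] u0.
  by under eq_fun do rewrite big_nil; exact: cvg_cst.
under eq_fun do rewrite big_cons.
have ur : forall j, j \in r -> u j n @[n --> \oo] --> 0.
  by move=> j jr; apply: u0; rewrite inE jr orbT.
have := cvgD (u0 i (mem_head i r)) (IH ur).
by rewrite addr0; exact.
Qed.

Theorem corollary5p7 (R : realType) (m0 m : nat) (f F : R -> R)
  (hm0 : (1 <= m0)%N) (hm : (m0 <= m)%N)
  (hf : Cminus (2 * m) f)
  (hlim : forall j : nat, (m0 <= j < m)%N ->
     f^`(2 * j - 1)%classic x @[x --> +oo] --> 0)
  (hint : (\int[@lebesgue_measure R]_(x in `[0%R, +oo[)
     (`|f^`(2 * m - 1)%classic x|%R)%:E < +oo)%E)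
  (hF : antiderivative F f)
  (c : nat) :
  cvg (EM_partial m0 f F @ \oo) /\
  EM_sum m0 f F
  = \sum_(0 <= k < c.+1) f k%:R - G_EM m F c.+1 + R_EM m (f \o shift c%:R).
Proof.
have FS i : F^`(i.+1)%classic = f^`(i)%classic.
  rewrite derive1Sn; congr (_^`(i)%classic); apply/funext => x.
  by rewrite derive1E; case: (hF x).
suff lim : EM_partial m0 f F @ \oo -->
    \sum_(0 <= k < c.+1) f k%:R - G_EM m F c.+1 + R_EM m (f \o shift c%:R).
  by split; [apply/cvg_ex; eexists; exact: lim | exact: cvg_lim lim].
(* This sum is the difference between the corrections for [m] and [m0]; by [FS] its derivatives of
   [F] are the [f^(2j-1)] of [hlim]. *)
have tail_cvg0 : (fun n : nat => \sum_(m0 <= j < m)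
    bernoulli_number R (2 * j) / (2 * j)`!%:R * F^`(2 * j)%classic (n%:R - 1))
    @ \oo --> (0 : R).
  have nat1y : (n%:R - 1 : R) @[n --> \oo] --> +oo.
    apply/cvgryPge => A; near=> n; rewrite lerBrDr.
    by near: n; exact: nbhs_infty_ger.
  apply: cvg_sum0 => j; rewrite mem_index_iota => jm.
  rewrite -(mulr0 (bernoulli_number R (2 * j) / (2 * j)`!%:R)).
  apply: cvgMr.
  (* Natural subtraction is exact here, as [j >= m0 >= 1]. *)
  have -> : (2 * j = (2 * j - 1).+1)%N.
    by rewrite subn1 prednK// muln_gt0/= (leq_trans hm0)//; case/andP: jm.
  by rewrite FS; apply: cvg_comp nat1y (hlim j jm).
have partialE n : EM_partial m0 f F n = EM_partial m f F n
    + \sum_(m0 <= j < m)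
    bernoulli_number R (2 * j) / (2 * j)`!%:R * F^`(2 * j)%classic (n%:R - 1).
  by rewrite /EM_partial /G_EM (big_cat_nat hm0 hm)/=; ring.
suff lim : EM_partial m f F @ \oo -->
    \sum_(0 <= k < c.+1) f k%:R - G_EM m F c.+1 + R_EM m (f \o shift c%:R).
  have := cvgD lim tail_cvg0; rewrite addr0 (funext partialE); exact.
(* From here on [m] stands for the former [m - 1], so the top order [2m - 1] becomes
   [(2 * m).+1]. *)
case: m hm hf hlim hint {tail_cvg0 partialE} => [|m] hm hf _ hint.
  by rewrite leqn0 in hm; rewrite (eqP hm) in hm0.
have m2 : (2 * m.+1 = (2 * m).+2)%N by rewrite mulnS.
rewrite m2 subn1 /= in hf hint.
case: hf => _ df cf _.
(* Translating by [c] puts the origin at the point where [G_EM m F c.+1] evaluates [F]. *)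
pose phi i := F^`(i)%classic \o shift (c%:R : R).
have dphi i : (i <= (2 * m).+1)%N ->
    forall x : R, is_derive x 1 (phi i) (phi i.+1 x).
  move=> im x; rewrite -[X in is_derive _ _ _ X]mulr1.
  apply: (@is_derive1_comp _ _ (shift (c%:R : R))); last exact: is_derive_shift.
  apply: DeriveDef; last by rewrite /phi /= derive1E.
  case: i im => [|i] im; first by rewrite derive1n0; case: (hF (x + c%:R)).
  by rewrite FS; exact: df.
have cphi : continuous (phi (2 * m).+2).
  rewrite /phi FS => x; apply: continuous_comp; last exact: cf.
  by apply: continuousD; [exact: cvg_id | exact: cvg_cst].
have iphi :
    (@lebesgue_measure R).-integrable `[0, +oo[ (EFin \o phi (2 * m).+2).
  rewrite /phi FS; apply: integrable_shift => //; exact: cf.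
have GE n : G_EM m.+1 F (n + c.+1) = EM_correction m.+1 (phi ^~ n%:R).
  rewrite /G_EM /EM_correction /phi /=.
  have -> // : (n + c.+1)%:R - 1 = n%:R + c%:R :> R.
  by rewrite addnS -natr1 addrK natrD.
(* Starting the sequence at [c.+1] leaves the limit unchanged and makes every term an instance of
   [euler_maclaurin_sum]. *)
rewrite -(cvg_shiftn c.+1).
have -> : [sequence EM_partial m.+1 f F (n + c.+1)]_n = (fun n =>
    \sum_(0 <= k < c.+1) f k%:R - G_EM m.+1 F c.+1 + ((2 * m).+1)`!%:R^-1 *
   \int[@lebesgue_measure R]_(x in `[0, n%:R[)
     (phi (2 * m).+2 x *
      (bernoulli_poly R (2 * m).+1).[x - (Num.floor x)%:~R])).
  apply/funext => n; rewrite euler_maclaurin_sum// /= /EM_partial GE.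
  rewrite -[in G_EM _ _ c.+1](add0n c.+1) GE.
  rewrite (@big_cat_nat _ _ _ c.+1)//= ?leq_addl//.
  (* Reindexed from 0, the tail has terms [f (k + c + 1)], that is [phi 1] at [k + 1]. *)
  have -> : \sum_(c.+1 <= k < n + c.+1) f k%:R
    = \sum_(0 <= k < n) phi 1%N (k%:R + 1).
    rewrite -{1}[c.+1]add0n big_addn addnK; apply: eq_bigr => k _.
    by rewrite /phi FS /= addnS -natr1 natrD; congr f; ring.
  ring.
apply: cvgD; first exact: cvg_cst.
rewrite /R_EM m2 subn1 [(2 * m).+2.-1]/=.
apply: cvgMr.
have -> : (f \o shift c%:R)^`((2 * m).+1)%classic = phi (2 * m).+2.
  by rewrite derive1n_shift /phi FS.
exact/cvg_Rintegral_nat/integrable_mul_frac.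
Unshelve. all: by end_near.
Qed.
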